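(* Let $\Sigma$ be an $(n-1)$-dimensional smooth oriented manifold, let $M=(0,\infty)\times\Sigma$ with the induced orientation, let $g$ be a Riemannian metric on $M$ with Riemannian volume form $\omega=dV_g$, and assume that $\int_{(0,r)\times\Sigma}\omega<\infty$ for all $r\in(0,\infty)$ and $\lim_{r\to0}\int_{(0,r)\times\Sigma}\omega=0$. Let $f:M\to[0,\infty)$ be smooth with compact support, and let $f^*$ be its symmetric decreasing rearrangement. Then for every $t>0$, $$\{x\in M: f^*(x)>t\}=\{x\in M: f(x)>t\}^*.$$
   Context: For an open set $A\subset M$ with $\int_A\omega<\infty$, the symmetric rearrangement of $A$ is the unique set $A^*\subset M$ of the form $A^*=(0,r_* )\times\Sigma$, with $r_*\in[0,\infty]$, such that $\int_{A^*}\omega=\int_A\omega$ (with $\emptyset^*=\emptyset$ and $M^*=M$). The symmetric decreasing rearrangement of $f:M\to[0,\infty)$ is the function $f^*:M\to[0,\infty)$, $$f^*(x)=\int_0^\infty \mathcal{X}_{\{y:f(y)>t\}^*}(x)\,dt,$$ where $\mathcal{X}_E$ denotes the characteristic function of $E$. *)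

(* Defs.v *)
From HB Require Import structures.
From mathcomp Require Import all_boot all_order all_algebra.
From mathcomp Require Import all_classical all_reals all_analysis.

Set Implicit Arguments.
Unset Strict Implicit.
Unset Printing Implicit Defensive.

Import Order.TTheory GRing.Theory Num.Theory.
Import numFieldNormedType.Exports.

Local Open Scope classical_set_scope.
Local Open Scope ring_scope.

(* Iterated directional derivatives; f is C^oo on the open set U iff all of
   them exist and are continuous on U. *)
Definition iter_derive (R : realType) (V W : normedModType R) (vs : seq V)
    (f : V -> W) : V -> W :=
  foldr (fun v h => 'D_v h) f vs.

Definition smooth_on (R : realType) (V W : normedModType R) (U : set V)
    (f : V -> W) : Prop :=
  forall (vs : seq V) (x : V), U x ->
    {for x, continuous (iter_derive vs f)} /\
    (forall v : V, derivable (iter_derive vs f) x v).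

(* n-dimensional Lebesgue measure, as an iterated product of the Lebesgue
   measure of the line (Borel sets of R^n being the measurable sets of the
   library's n.-tuple). *)
Fixpoint lebesgue_tuple (R : realType) (n : nat) :
    set (n.-tuple (measurableTypeR R)) -> \bar R :=
  match n return set (n.-tuple (measurableTypeR R)) -> \bar R with
  | 0 => dirac [tuple]
  | n'.+1 => pushforward
      (product_measure1 (@lebesgue_measure R) (@lebesgue_tuple R n'))
      (fun p : measurableTypeR R * n'.-tuple (measurableTypeR R) =>
         [tuple of p.1 :: p.2])
  end.

Definition row_of_tuple (R : realType) (n : nat)
    (y : n.-tuple (measurableTypeR R)) : 'rV[R]_n := \row_i tnth y i.

(* A chart is a homeomorphism from an open subset of T onto an open subset of
   R^n; [coord] and [param] are relevant on [dom] and [cod] only. *)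
Record chart (R : realType) (T : topologicalType) (n : nat) := Chart {
  dom : set T ;
  cod : set 'rV[R]_n ;
  coord : T -> 'rV[R]_n ;
  param : 'rV[R]_n -> T ;
  open_dom : open dom ;
  open_cod : open cod ;
  coord_cod : forall x, dom x -> cod (coord x) ;
  param_dom : forall y, cod y -> dom (param y) ;
  coordK : forall x, dom x -> param (coord x) = x ;
  paramK : forall y, cod y -> coord (param y) = y ;
  continuous_coord : forall x, dom x -> {for x, continuous coord} ;
  continuous_param : forall y, cod y -> {for y, continuous param}
}.

Definition transition (R : realType) (T : topologicalType) (n : nat)
    (c d : chart R T n) : 'rV[R]_n -> 'rV[R]_n :=
  coord d \o param c.

(* An orientation is a choice of atlas whose transition maps have positive
   Jacobian determinant. The library's ['J] acts on row vectors: ('J f p) i j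
   is the partial derivative of the j-th component of f in the i-th direction. *)
Definition oriented_smooth_atlas (R : realType) (T : topologicalType)
    (n : nat) (A : set (chart R T n)) : Prop :=
  [/\ forall x, exists2 c, A c & dom c x,
      forall c d, A c -> A d ->
        smooth_on (cod c `&` param c @^-1` dom d) (transition c d) &
      forall c d, A c -> A d -> forall x, dom c x -> dom d x ->
        0 < \det ('J (transition c d) (coord c x))].

Definition oriented_manifold (R : realType) (T : topologicalType) (n : nat)
    (A : set (chart R T n)) : Prop :=
  [/\ hausdorff_space T, @second_countable T & oriented_smooth_atlas A].

Definition smooth_function (R : realType) (T : topologicalType) (n : nat)
    (A : set (chart R T n)) (f : T -> R) : Prop :=
  forall c, A c -> smooth_on (cod c) (f \o param c : 'rV[R]_n -> R^o).

(* A Riemannian metric in coordinates: [g c x] is the matrix of the inner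
   product at x in the coordinate basis of the chart c. With row vectors, a
   tangent vector with components v in c has components v *m J in d. *)
Definition riemannian_metric (R : realType) (T : topologicalType) (n : nat)
    (A : set (chart R T n)) (g : chart R T n -> T -> 'M[R]_n) : Prop :=
  [/\ forall c, A c -> smooth_on (cod c) (g c \o param c),
      forall c, A c -> forall x, dom c x ->
        (g c x)^T = g c x /\
        forall v : 'rV[R]_n, v != 0 -> 0 < (v *m g c x *m v^T) ord0 ord0 &
      forall c d, A c -> A d -> forall x, dom c x -> dom d x ->
        let J := 'J (transition c d) (coord c x) in
        g c x = J *m g d x *m J^T].

(* A form of top degree is given by its coefficients: in each positively
   oriented chart c it is w c * dx_1 /\ ... /\ dx_n. *)
Definition volume_form (R : realType) (T : topologicalType) (n : nat)
    (g : chart R T n -> T -> 'M[R]_n) (c : chart R T n) (x : T) : R :=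
  Num.sqrt (\det (g c x)).

Definition chart_image (R : realType) (T : topologicalType) (n : nat)
    (c : chart R T n) (E : set T) : set (n.-tuple (measurableTypeR R)) :=
  [set y | cod c (row_of_tuple y) /\ E (param c (row_of_tuple y))].

Definition chart_integral (R : realType) (T : topologicalType) (n : nat)
    (c : chart R T n) (w : T -> R) (E : set T) : \bar R :=
  (\int[@lebesgue_tuple R n]_(y in chart_image c E)
     (w (param c (row_of_tuple y)))%:E)%E.

(* Integral over B of a nonnegative form w of top degree: the supremum of the
   sums of its integrals over finitely many disjoint Borel pieces of B, each
   lying in the domain of an oriented chart and computed in that chart. On a
   second countable T this is the sum over any countable partition of a Borel
   set B into such pieces. *)
Definition form_integral (R : realType) (T : topologicalType) (n : nat)
    (A : set (chart R T n)) (w : chart R T n -> T -> R) (B : set T) : \bar R :=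
  ereal_sup [set s | exists (k : nat) (c : 'I_k -> chart R T n)
                            (E : 'I_k -> set T),
    [/\ forall i, A (c i),
        forall i, E i `<=` dom (c i) `&` B,
        forall i, measurable (chart_image (c i) (E i)),
        trivIset setT E &
        s = (\sum_(i < k) chart_integral (c i) (w (c i)) (E i))%E]].

Definition riemannian_volume (R : realType) (T : topologicalType) (n : nat)
    (A : set (chart R T n)) (g : chart R T n -> T -> 'M[R]_n) :
    set T -> \bar R :=
  form_integral A (volume_form g).

Definition half_line (R : realType) : set R := `]0, +oo[.
Arguments half_line : clear implicits.

Definition half_cylinder (R : realType) (Sigma : topologicalType) :
  topologicalType := (set_type (half_line R) * Sigma)%type.

Section ProductChart.
Variables (R : realType) (Sigma : topologicalType) (m : nat).
Variable c : chart R Sigma m.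
Let M := half_cylinder R Sigma.

Fact one_half_line : (1 : R) \in half_line R.
Proof. by rewrite inE /= /half_line /= in_itv /= ltr01. Qed.

Definition to_half_line (r : R) : set_type (half_line R) :=
  insubd (exist _ 1 one_half_line) r.

Lemma to_half_lineK (r : R) : 0 < r -> val (to_half_line r) = r.
Proof.
by move=> r0; apply: insubdK; rewrite inE /= /half_line /= in_itv /= r0.
Qed.

Lemma half_line_gt0 (r : set_type (half_line R)) : 0 < val r.
Proof. by have := valP r; rewrite inE /= /half_line /= in_itv /= andbT. Qed.

Lemma val_half_lineK (r : set_type (half_line R)) : to_half_line (val r) = r.
Proof. by apply/val_inj; rewrite to_half_lineK// half_line_gt0. Qed.

Lemma cvg_mx (S : Type) (F : set_system S) {FF : Filter F} p q
    (f : S -> 'M[R]_(p, q)) (l : 'M[R]_(p, q)) :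
  (forall i j, f x i j @[x --> F] --> l i j) -> f @ F --> l.
Proof.
move=> fl U [P nP sPU]; rewrite /nbhs /=.
have : F [set x | forall i, (forall j, P i j (f x i j))].
  apply: filter_forall => i; apply: filter_forall => j.
  exact: fl (nP i j).
by apply: filterS => x Px; apply: sPU.
Qed.

Lemma rsubmx_continuous : continuous (@rsubmx R 1 1 m).
Proof.
move=> y; apply: (@cvg_mx _ (nbhs y)) => i j; rewrite mxE.
under eq_fun do rewrite mxE.
exact: (@coord_continuous R).
Qed.

Definition prod_dom : set M := [set x | dom c x.2].
Definition prod_cod : set 'rV[R]_(1 + m) :=
  [set y : 'rV[R]_(1 + m) | 0 < y ord0 (lshift m ord0) /\ cod c (rsubmx y)].
Definition prod_coord (x : M) : 'rV[R]_(1 + m) :=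
  row_mx (val x.1)%:M (coord c x.2).
Definition prod_param (y : 'rV[R]_(1 + m)) : M :=
  (to_half_line (y ord0 (lshift m ord0)), param c (rsubmx y)).

Fact prod_open_dom : open prod_dom.
Proof.
apply: (open_comp (f := snd)); last exact: open_dom.
by move=> x _; exact: cvg_snd.
Qed.

Fact prod_open_cod : open prod_cod.
Proof.
have -> : prod_cod =
    (fun y : 'rV[R]_(1 + m) => y ord0 (lshift m ord0)) @^-1` [set r | 0 < r]
    `&` @rsubmx R 1 1 m @^-1` cod c by [].
apply: openI; apply: open_comp; try exact: open_gt; try exact: open_cod.
- by move=> y _; exact: (@coord_continuous R 1 (1 + m) ord0 (lshift m ord0) y).
- by move=> y _; exact: rsubmx_continuous.
Qed.

Fact prod_coord_cod x : prod_dom x -> prod_cod (prod_coord x).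
Proof.
move=> xc; split; last by rewrite row_mxKr; exact: coord_cod.
by rewrite row_mxEl mxE eqxx mulr1n half_line_gt0.
Qed.

Fact prod_param_dom y : prod_cod y -> prod_dom (prod_param y).
Proof. by move=> [_ yc]; exact: param_dom. Qed.

Fact prod_coordK x : prod_dom x -> prod_param (prod_coord x) = x.
Proof.
case: x => r s xc; rewrite /prod_param row_mxKr coordK//=.
by rewrite row_mxEl mxE eqxx mulr1n val_half_lineK.
Qed.

Fact prod_paramK y : prod_cod y -> prod_coord (prod_param y) = y.
Proof.
move=> [y0 yc]; rewrite /prod_coord /= paramK// to_half_lineK//.
rewrite -[RHS]hsubmxK; congr row_mx; apply/rowP => i.
by rewrite [i]ord1 !mxE eqxx mulr1n.
Qed.

Fact prod_coord_continuous x : prod_dom x -> {for x, continuous prod_coord}.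
Proof.
move=> xc; apply: (@cvg_mx _ (nbhs x)) => i j; rewrite /prod_coord.
case: (split_ordP j) => k ->.
  have E z : row_mx (val z.1)%:M (coord c z.2) i (lshift m k) = val z.1 :> R.
    by rewrite row_mxEl [i]ord1 [k]ord1 !mxE eqxx mulr1n.
  rewrite E (_ : (fun z => _) = (fun z : M => val z.1)); last exact/funext.
  apply: (@cvg_comp _ _ _ fst val); first exact: cvg_fst.
  exact: initial_continuous.
have E z : row_mx (val z.1)%:M (coord c z.2) i (rshift 1 k) = coord c z.2 i k :> R.
  by rewrite row_mxEr.
rewrite E (_ : (fun z => _) = (fun z : M => coord c z.2 i k)); last exact/funext.
apply: (@cvg_comp _ _ _ snd (fun s => coord c s i k)); first exact: cvg_snd.
apply: (@cvg_comp _ _ _ (coord c) (fun v => v i k)).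
  exact: continuous_coord xc.
exact: (@coord_continuous R).
Qed.

Fact prod_param_continuous y : prod_cod y -> {for y, continuous prod_param}.
Proof.
move=> [y0 yc].
have c1 : to_half_line (v ord0 (lshift m ord0)) @[v --> y] -->
    to_half_line (y ord0 (lshift m ord0)).
  move=> U; rewrite nbhsE => -[_ [[B oB <-] By] BU].
  have By0 : nbhs (y ord0 (lshift m ord0)) (B `&` [set r | 0 < r]).
    apply: filterI; last exact: lt_nbhsr.
    apply: open_nbhs_nbhs; split=> //.
    by move: By; rewrite /= set_valE to_half_lineK.
  have Ny : nbhs y [set v : 'rV[R]_(1 + m) |
      (B `&` [set r | 0 < r]) (v ord0 (lshift m ord0))].
    exact: (@coord_continuous R 1 (1 + m) ord0 (lshift m ord0) y _ By0).
  suff : nbhs y [set v : 'rV[R]_(1 + m) |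
      U (to_half_line (v ord0 (lshift m ord0)))] by [].
  apply: filterS Ny.
  by move=> v [Bv v0]; apply: BU; rewrite /= set_valE to_half_lineK.
have c2 : param c (rsubmx v) @[v --> y] --> param c (rsubmx y).
  apply: (@cvg_comp _ _ _ (@rsubmx R 1 1 m) (param c)).
    exact: rsubmx_continuous.
  exact: continuous_param.
exact: (cvg_pair (FF := nbhs_filter y) (FG := nbhs_filter _)
                 (FH := nbhs_filter _) c1 c2).
Qed.

Definition prod_chart : chart R (half_cylinder R Sigma) (1 + m) :=
  Chart prod_open_dom prod_open_cod prod_coord_cod prod_param_dom
        prod_coordK prod_paramK prod_coord_continuous prod_param_continuous.

End ProductChart.

(* The coordinate of the half line comes first in the product orientation. *)
Definition prod_atlas (R : realType) (Sigma : topologicalType) (m : nat)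
    (A : set (chart R Sigma m)) : set (chart R (half_cylinder R Sigma) (1 + m)) :=
  [set prod_chart c | c in A].

Definition slab (R : realType) (Sigma : topologicalType) (r : \bar R) :
    set (half_cylinder R Sigma) :=
  [set x | ((val x.1)%:E < r)%E].

(* The clauses on set0 and setT are conventions; for any other B of finite
   volume the condition in xget determines the set uniquely under the
   assumptions of the theorem. *)
Definition symmetric_rearrangement (R : realType) (Sigma : topologicalType)
    (vol : set (half_cylinder R Sigma) -> \bar R)
    (B : set (half_cylinder R Sigma)) : set (half_cylinder R Sigma) :=
  if `[< B = set0 >] then set0
  else if `[< B = setT >] then setT
  else xget set0
    [set S | exists r : \bar R, [/\ (0 <= r)%E, S = slab r & vol S = vol B]].

Definition decreasing_rearrangement (R : realType) (Sigma : topologicalType)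
    (vol : set (half_cylinder R Sigma) -> \bar R)
    (f : half_cylinder R Sigma -> R) (x : half_cylinder R Sigma) : R :=
  \int[@lebesgue_measure R]_(t in `]0, +oo[)
    \1_(symmetric_rearrangement vol [set y | t < f y]) x.

(* Main.v *)
Require Import Defs.
From HB Require Import structures.
From mathcomp Require Import all_boot all_order all_algebra.
From mathcomp Require Import all_classical all_reals all_analysis.
From mathcomp Require Import measurable_realfun perm ring.

Set Implicit Arguments.
Unset Strict Implicit.
Unset Printing Implicit Defensive.

Import Order.TTheory GRing.Theory Num.Theory.
Import numFieldNormedType.Exports.

Local Open Scope classical_set_scope.
Local Open Scope ring_scope.

(* Let V r be the volume of the slab (0, r) x Sigma. As a function of the set,
   the volume is a supremum of measures, one for each finite family of disjoint
   pieces, and cutting the pieces makes it finitely additive and continuous from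
   below, so no change of variables between charts is needed. Since the volume
   density is positive, slices {r} x Sigma are null and small slabs have small
   volume, V is strictly increasing and continuous. Hence for a bounded B of
   finite volume, B^* = {x | V (x.1) < vol B} by the intermediate value
   property. Therefore f^*(x) is the length of the set of levels u > 0 with
   V (x.1) < vol {f > u}. This set is an interval starting at 0, and it is open
   on the right because vol {f > u} is right-continuous in u, so f^*(x) > t iff
   t belongs to it, i.e. iff x is in {f > t}^*. *)

(** * Lebesgue measure on tuples *)

Section LebesgueTuple.
Variable R : realType.
Local Notation leb n := (@lebesgue_tuple R n).
Local Notation mu := (@lebesgue_measure R).

Lemma measurable_cons_tuple n : measurable_fun setT
  (fun p : measurableTypeR R * n.-tuple (measurableTypeR R) =>
     [tuple of p.1 :: p.2]).
Proof. exact: measurable_cons. Qed.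

Lemma pushforward_cons_tuple n
    (m : {sigma_finite_measure set (n.-tuple (measurableTypeR R)) -> \bar R})
    (X : set (measurableTypeR R)) (Y : set (n.-tuple (measurableTypeR R))) :
  measurable X -> measurable Y ->
  pushforward (mu \x m)%E (fun p : measurableTypeR R * n.-tuple _ =>
      [tuple of p.1 :: p.2])
    [set y | X (thead y) /\ Y [tuple of behead y]] = (mu X * m Y)%E.
Proof.
move=> mX mY; rewrite -product_measure1E// /pushforward; congr (_ _).
apply/funext => -[x y] /=; rewrite theadE.
by rewrite (_ : [tuple of _] = y)//; apply: val_inj.
Qed.

Lemma measurable_thead_behead n (X : set (measurableTypeR R))
    (Y : set (n.-tuple (measurableTypeR R))) :
  measurable X -> measurable Y ->
  measurable [set y : n.+1.-tuple _ | X (thead y) /\ Y [tuple of behead y]].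
Proof.
move=> mX mY; apply: measurableI.
  rewrite -[X in measurable X]setTI; exact: measurable_tnth.
rewrite -[X in measurable X]setTI; exact: measurable_behead.
Qed.

(** [lebesgue_tuple] is a bare set function; the integration lemmas apply once it is rewritten into
    a measure structure by this equality. Sigma-finiteness is carried along because the induction
    step uses it for the next product measure. *)
Lemma lebesgue_tuple_sigma_finite n :
  exists m : {sigma_finite_measure set (n.-tuple (measurableTypeR R)) -> \bar R},
    leb n = m.
Proof.
elim: n => [|n [m mE]].
  by exists (dirac [tuple]).
pose q : {measure set (n.+1.-tuple (measurableTypeR R)) -> \bar R} :=
  measure_function_pushforward__canonical__measure_function_Measure
    (mu \x m)%E (@measurable_cons_tuple n).
have -> : leb n.+1 = q by rewrite /= mE.
have qsf : sigma_finite setT q.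
  have /sigma_finiteP[F [FT ndF Ffin]] := sigma_finiteT mu.
  have /sigma_finiteP[G [GT ndG Gfin]] := sigma_finiteT m.
  (* Both exhaustions increase, so one index suffices: a point of [F i] and [G j] is caught at index
     [maxn i j]. *)
  exists (fun i => [set y | F i (thead y) /\ G i [tuple of behead y]]).
    apply/seteqP; split => // y _ /=.
    have [i _ Fi] : (\bigcup_i F i) (thead y) by rewrite -FT.
    have [j _ Gj] : (\bigcup_i G i) [tuple of behead y] by rewrite -GT.
    exists (maxn i j) => //; split.
      by move: Fi; apply/subsetPset/ndF/leq_maxl.
    by move: Gj; apply/subsetPset/ndG/leq_maxr.
  move=> i; have [mF Fi] := Ffin i; have [mG Gi] := Gfin i.
  split; first exact: measurable_thead_behead.
  by rewrite [ltLHS]pushforward_cons_tuple// lte_mul_pinfty// ge0_fin_numE.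
by exists (HB.pack_for
  {sigma_finite_measure set (n.+1.-tuple (measurableTypeR R)) -> \bar R}
  (q : set _ -> \bar R) (Measure.class q)
  (Measure_isSigmaFinite.Build _ _ _ q qsf)).
Qed.

Lemma lebesgue_tuple_cons n (X : set (measurableTypeR R))
    (Y : set (n.-tuple (measurableTypeR R))) :
  measurable X -> measurable Y ->
  leb n.+1 [set y | X (thead y) /\ Y [tuple of behead y]] = (mu X * leb n Y)%E.
Proof.
move=> mX mY; have [m mE] := lebesgue_tuple_sigma_finite n.
by rewrite [lebesgue_tuple _]/= mE pushforward_cons_tuple.
Qed.

Lemma measurable_tuple_box n (P : 'I_n -> set (measurableTypeR R)) :
  (forall i, measurable (P i)) ->
  measurable [set y : n.-tuple (measurableTypeR R) | forall i, P i (tnth y i)].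
Proof.
move=> mP.
rewrite (_ : [set y | _] =
    \bigcap_(i in [set: 'I_n]) ((fun y : n.-tuple (measurableTypeR R) => tnth y i) @^-1` P i)).
  apply: fin_bigcap_measurable => // i _.
  rewrite -[X in measurable X]setTI.
  apply: (@measurable_tnth _ (measurableTypeR R) n i measurableT).
  exact: mP.
by apply/seteqP; split => y /= Py i; [move=> _; exact: Py|exact: Py].
Qed.

(** These boxes are the balls of row vectors; their positive measure is the source of the positive
    volume of nonempty open sets. The box is split as an interval times a box of one dimension
    less. *)
Lemma lebesgue_tuple_box_gt0 n (a : 'I_n -> R) (e : R) : 0 < e ->
  (0 < leb n [set y | forall i, (`|a i - tnth y i| < e)%R])%E.
Proof.
move=> e0; elim: n a => [|n IHn] a.
  by rewrite /= diracE mem_set ?lte01// => -[].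
pose X : set R := ball (a ord0) e.
pose Y := [set y : n.-tuple (measurableTypeR R) |
  forall i, `|a (lift ord0 i) - tnth y i| < e].
have mball (b : R) : measurable (ball b e : set (measurableTypeR R)).
  by apply: open_measurable; exact: ball_open.
have mX : measurable (X : set (measurableTypeR R)) by exact: mball.
have mY : measurable Y.
  exact: (@measurable_tuple_box _ (fun i => ball (a (lift ord0 i)) e)).
rewrite (_ : [set y | _] = [set y | X (thead y) /\ Y [tuple of behead y]]).
  rewrite lebesgue_tuple_cons// mule_gt0 ?IHn//.
  by rewrite /X lebesgue_measure_ball ?ltW// lte_fin pmulrn_rgt0.
apply/seteqP; split => y /=.
  move=> ya; split; first exact: ya.
  move=> i; have := ya (lift ord0 i); congr (`|_ - _| < _).
  by rewrite [in LHS](tuple_eta y) tnthS.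
move=> [y0 yS] i; case: (unliftP ord0 i) => [j ->|->]; last exact: y0.
by rewrite [y]tuple_eta tnthS; move: (yS j); congr (`|_ - _| < _).
Qed.

Lemma lebesgue_tuple_hyperplane n (r : R) :
  leb n.+1 [set y | tnth y ord0 = r] = 0%E.
Proof.
rewrite (_ : [set y | _] = [set y | [set r] (thead y) /\ setT [tuple of behead y]]).
  by rewrite lebesgue_tuple_cons// lebesgue_measure_set1 mul0e.
by apply/seteqP; split => y //= [].
Qed.

End LebesgueTuple.

(** * Open sets of row vectors are Borel sets of tuples *)

Section OpenMeasurable.
Variables (R : realType) (n : nat).
Local Notation V := 'rV[R]_n.
Local Notation rowt := (@row_of_tuple R n).

(** The measurable sets of tuples are described through coordinates, not through the topology of row
    vectors. The link is that an open set is the countable union of the boxes with rational centre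
    and radius [k.+1%:R^-1] that it contains. *)
Lemma measurable_row_open (U : set V) : open U -> measurable (rowt @^-1` U).
Proof.
move=> oU.
pose box (q : {ffun 'I_n -> rat}) (k : nat) : set V :=
  [set y | forall i, `|ratr (q i) - y ord0 i| < k.+1%:R^-1].
rewrite (_ : rowt @^-1` U = \bigcup_(qk : {ffun 'I_n -> rat} * nat)
    if `[< box qk.1 qk.2 `<=` U >] then rowt @^-1` box qk.1 qk.2 else set0).
  apply: countable_bigcupT_measurable; first exact: countableP.
  move=> [q k] /=; case: asboolP => // _.
  rewrite (_ : _ @^-1` _ = [set y : n.-tuple (measurableTypeR R) |
      forall i : 'I_n, (ball (ratr (q i) : R) k.+1%:R^-1 : set R) (tnth y i)]).
    apply: (measurable_tuple_box (P := fun i => ball (ratr (q i) : R) k.+1%:R^-1)).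
    by move=> i; apply: open_measurable; exact: ball_open.
  by apply/seteqP; split => y /= yq i; move: (yq i); rewrite mxE.
apply/seteqP; split => y /=; last first.
  by move=> [[q k] _ /=]; case: asboolP => // + yq; apply.
move=> Uy.
have [e /= e0 eU] : nbhs_ball (rowt y) U.
  by rewrite nbhs_ballE; exact: open_nbhs_nbhs.
(* Half of [e] bounds the distance from [y] to the rational centre, the other half the distance from
   that centre to a point of the box. *)
have e20 : 0 < e / 2 by rewrite divr_gt0.
have [k _ /(_ _ (leqnn k)) /= ke] := near_infty_natSinv_lt (PosNum e20).
have qP i : exists q : rat, `|ratr q - tnth y i| < k.+1%:R^-1.
  have /rat_in_itvoo[q] : tnth y i < tnth y i + k.+1%:R^-1 by rewrite ltrDl invr_gt0.
  rewrite in_itv /= => /andP[q1 q2]; exists q.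
  by rewrite ger0_norm ?subr_ge0 ?ltW// ltrBlDl.
have /choice[q {}qP] := qP.
exists ([ffun i => q i], k) => //=; case: asboolP => [_|[]].
  by move=> i; rewrite ffunE mxE.
move=> z zq; apply: eU; split => // i j; rewrite [i]ord1 mxE /ball/=.
have := zq j; rewrite ffunE => {}zq.
rewrite -(subrK (ratr (q j)) (tnth y j)) -addrA (le_lt_trans (ler_normD _ _))//.
rewrite [e]splitr ltrD//.
  by rewrite distrC (lt_trans (qP j)).
exact: lt_trans ke.
Qed.

(** Continuity is asked only on [U], since a map composed with [param] is controlled on [cod]
    alone. *)
Lemma measurable_row_continuous (U : set V) (D : set (n.-tuple (measurableTypeR R)))
    (phi : V -> R) :
  open U -> (forall y, U y -> {for y, continuous phi}) -> D `<=` rowt @^-1` U ->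
  measurable_fun D (phi \o rowt).
Proof.
move=> oU cphi DU mD.
apply: (measurability _ (RGenOpens.measurableE R)) => //.
move=> _ [_ [a [b ->] <-]].
rewrite (_ : _ `&` _ = D `&` rowt @^-1` (U `&` phi @^-1` `]a, b[%classic)).
  apply: measurableI => //; apply: measurable_row_open.
  rewrite openE => y [Uy Py]; apply: filterI; first exact: open_nbhs_nbhs.
  by apply: (cphi y Uy); apply: open_nbhs_nbhs; split=> //; exact: interval_open.
by apply/seteqP; split => y /= [Dy Py]; split => //; [split=> //; exact: DU|case: Py].
Qed.

End OpenMeasurable.

(** * Additivity and continuity from below of the integral of a form *)

Section FormIntegral.
Variables (R : realType) (T : topologicalType) (n : nat).
Variables (A : set (chart R T n)) (w : chart R T n -> T -> R).
Hypothesis w_ge0 : forall c x, 0 <= w c x.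
Hypothesis w_cont : forall c, A c ->
  forall y, cod c y -> {for y, continuous (w c \o param c)}.

(** Borel measurability in [T], tested chart by chart. *)
Definition chart_measurable (B : set T) :=
  forall c, A c -> measurable (chart_image c B).

Lemma chart_imageI (c : chart R T n) (B C : set T) :
  chart_image c (B `&` C) = chart_image c B `&` chart_image c C.
Proof.
apply/seteqP; split => y /=; first by move=> [cy [By Cy]].
by move=> [[cy By] [_ Cy]].
Qed.

Lemma chart_imageU (c : chart R T n) (B C : set T) :
  chart_image c (B `|` C) = chart_image c B `|` chart_image c C.
Proof.
apply/seteqP; split => y /=; first by move=> [? []]; [left|right].
by move=> [[? ?]|[? ?]]; split => //; [left|right].
Qed.

Lemma chart_image_bigcup (c : chart R T n) (F : nat -> set T) :
  chart_image c (\bigcup_k F k) = \bigcup_k chart_image c (F k).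
Proof.
apply/seteqP; split => y /=.
  by move=> [cy [k _ Fk]]; exists k.
by move=> [k _ [cy Fk]]; split=> //; exists k.
Qed.

Lemma measurable_fun_chart (c : chart R T n) (E : set T) : A c ->
  measurable_fun (chart_image c E)
    (fun y => (w c (param c (row_of_tuple y)))%:E).
Proof.
move=> Ac; apply/measurable_EFinP.
apply: (@measurable_row_continuous _ _ (cod c) _ (w c \o param c)).
- exact: open_cod.
- exact: w_cont.
- by move=> y [].
Qed.

Lemma chart_integral_ge0 (c : chart R T n) (E : set T) :
  (0 <= chart_integral c (w c) E)%E.
Proof.
have [m mE] := lebesgue_tuple_sigma_finite R n.
by rewrite /chart_integral mE; apply: integral_ge0 => y _; rewrite lee_fin.
Qed.

Lemma chart_integralU (c : chart R T n) (B C : set T) : A c ->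
  measurable (chart_image c B) -> measurable (chart_image c C) ->
  B `&` C = set0 ->
  chart_integral c (w c) (B `|` C) =
  (chart_integral c (w c) B + chart_integral c (w c) C)%E.
Proof.
move=> Ac mB mC BC; have [m mE] := lebesgue_tuple_sigma_finite R n.
rewrite /chart_integral mE chart_imageU ge0_integral_setU//.
- by rewrite -chart_imageU; exact: measurable_fun_chart.
- by move=> y _; rewrite lee_fin.
- by rewrite disj_set2E -chart_imageI BC; apply/eqP/seteqP; split => y // [].
Qed.

Lemma chart_integral_cvg (c : chart R T n) (F : (set T)^nat) : A c ->
  nondecreasing_seq F -> (forall k, measurable (chart_image c (F k))) ->
  chart_integral c (w c) (F k) @[k --> \oo] -->
  chart_integral c (w c) (\bigcup_k F k).
Proof.
move=> Ac ndF mF; have [m mE] := lebesgue_tuple_sigma_finite R n.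
rewrite /chart_integral mE chart_image_bigcup.
apply: ge0_nondecreasing_set_cvg_integral => //.
- move=> i j ij; apply/subsetPset => y [cy Fy]; split => //.
  by move: Fy; exact/subsetPset/ndF.
- by move=> k; exact: measurable_fun_chart.
- by move=> k y _; rewrite lee_fin.
Qed.

Lemma le_form_integral (B C : set T) : B `<=` C ->
  (form_integral A w B <= form_integral A w C)%E.
Proof.
move=> BC; apply: ge_ereal_sup => _ [k [c [E [Ac EB mE tE ->]]]].
apply: ereal_sup_ubound; exists k, c, E; split => // i x Ex.
by have [] := EB i x Ex; split => //; exact: BC.
Qed.

Lemma form_integral_ge0 (B : set T) : (0 <= form_integral A w B)%E.
Proof.
apply: ereal_sup_ubound.
have c0 (i : 'I_0) : chart R T n by case: i.
exists 0%N, c0, (fun=> set0); by split; rewrite ?big_ord0//; case.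
Qed.

Lemma chart_integral_le_form (c : chart R T n) (E B : set T) : A c ->
  E `<=` dom c `&` B -> measurable (chart_image c E) ->
  (chart_integral c (w c) E <= form_integral A w B)%E.
Proof.
move=> Ac EB mE; apply: ereal_sup_ubound.
exists 1%N, (fun=> c), (fun=> E); split => //.
  by move=> i j _ _ _; rewrite (ord1 i) (ord1 j).
by rewrite big_ord1.
Qed.

(** A family of pieces for [B] and one for [C] concatenate into a family for the union, still
    disjoint because [B] and [C] are. *)
Lemma form_integral_superadditive (B C : set T) : B `&` C = set0 ->
  (form_integral A w B + form_integral A w C <= form_integral A w (B `|` C))%E.
Proof.
move=> BC; set v := form_integral A w (B `|` C).
(* If [v] is infinite the claim is trivial; otherwise every term is finite, and subtraction lets the
   two suprema be treated one after the other. *)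
have [->|vy] := eqVneq v +oo%E; first by rewrite leey.
have fin D : D `<=` B `|` C -> form_integral A w D \is a fin_num.
  move=> /le_form_integral DBC; rewrite ge0_fin_numE ?form_integral_ge0//.
  by rewrite (le_lt_trans DBC)// lt_neqAle vy leey.
have finB := fin _ (@subsetUl _ B C); have finC := fin _ (@subsetUr _ B C).
rewrite -leeBrDr//; apply: ge_ereal_sup => s1 Ss1.
have s1fin : s1 \is a fin_num.
  have s1B : (s1 <= form_integral A w B)%E by exact: ereal_sup_ubound.
  rewrite ge0_fin_numE; first by rewrite (le_lt_trans s1B)// -ge0_fin_numE ?form_integral_ge0.
  case: Ss1 => [k [c [E [_ _ _ _ ->]]]].
  by apply: sume_ge0 => i _; exact: chart_integral_ge0.
rewrite leeBrDr// addeC -leeBrDr//; apply: ge_ereal_sup => s2 Ss2.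
rewrite leeBrDr// addeC; apply: ereal_sup_ubound.
case: Ss1 => [k1 [c1 [E1 [Ac1 EB1 mE1 tE1 ->]]]].
case: Ss2 => [k2 [c2 [E2 [Ac2 EB2 mE2 tE2 ->]]]].
have split_l i : fintype.split (lshift k2 i) = inl i := unsplitK (inl i).
have split_r i : fintype.split (rshift k1 i) = inr i := unsplitK (inr i).
exists (k1 + k2)%N,
  (fun i => match fintype.split i with inl j => c1 j | inr j => c2 j end),
  (fun i => match fintype.split i with inl j => E1 j | inr j => E2 j end); split.
- by move=> i; case: splitP.
- move=> i; case: splitP => j _ x Ex.
    by have [? ?] := EB1 j x Ex; split=> //; left.
  by have [? ?] := EB2 j x Ex; split=> //; right.
- by move=> i; case: splitP.
- have EE i j x : E1 i x -> E2 j x -> False.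
    move=> /EB1[_ Bx] /EB2[_ Cx].
    by have : (B `&` C) x by []; rewrite BC.
  move=> i j _ _.
  case: (split_ordP i) => i' ->; case: (split_ordP j) => j' -> [x []].
  + rewrite ?split_l => Ei Ej.
    by congr lshift; apply: tE1 => //; exists x.
  + by rewrite ?split_l ?split_r => /EE/[apply].
  + rewrite ?split_r ?split_l.
    by move=> /[swap] /EE/[apply].
  + rewrite ?split_r => Ei Ej.
    by congr rshift; apply: tE2 => //; exists x.
- rewrite big_split_ord /=; congr (_ + _)%E; apply: eq_bigr => i _.
    by rewrite split_l.
  by rewrite split_r.
Qed.

(** Each piece of a family for the union is cut along [B] and [C]; measurability of these sets keeps
    the cut pieces admissible. *)
Lemma form_integral_subadditive (B C : set T) :
  chart_measurable B -> chart_measurable C -> B `&` C = set0 ->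
  (form_integral A w (B `|` C) <= form_integral A w B + form_integral A w C)%E.
Proof.
move=> mB mC BC; apply: ge_ereal_sup => _ [k [c [E [Ac EBC mE tE ->]]]].
have EBE i : E i = (E i `&` B) `|` (E i `&` C).
  by rewrite -setIUr; apply/esym/setIidPl => x /EBC[].
have sub D : chart_measurable D ->
    (\sum_(i < k) chart_integral (c i) (w (c i)) (E i `&` D) <=
     form_integral A w D)%E.
  move=> mD; apply: ereal_sup_ubound; exists k, c, (fun i => E i `&` D).
  split => //.
  - by move=> i x [/EBC[? _] ?].
  - by move=> i; rewrite chart_imageI; apply: measurableI => //; exact: mD.
  - by move=> i j _ _ [x [[Ei _] [Ej _]]]; apply: tE => //; exists x.
apply: le_trans (leeD (sub _ mB) (sub _ mC)).
rewrite -big_split/=; apply: lee_sum => i _.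
rewrite {1}EBE chart_integralU//.
- by rewrite chart_imageI; apply: measurableI => //; exact: mB.
- by rewrite chart_imageI; apply: measurableI => //; exact: mC.
- by rewrite setIACA BC setI0.
Qed.

(* For each fixed family of pieces the sum is a measure, so that the supremum
   over the families inherits continuity from below. *)
Lemma form_integral_bigcup_gt (F : (set T)^nat) (x : \bar R) :
  nondecreasing_seq F -> (forall k, chart_measurable (F k)) ->
  (x < form_integral A w (\bigcup_k F k))%E ->
  exists k, (x < form_integral A w (F k))%E.
Proof.
move=> ndF mF /ereal_sup_gt[_ [k [c [E [Ac EF mE tE ->]]]] xs].
pose s l := (\sum_(i < k) chart_integral (c i) (w (c i)) (E i `&` F l))%E.
have EFU i : E i = \bigcup_l (E i `&` F l).
  by rewrite -setI_bigcupr; apply/esym/setIidPl => y /EF[].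
have scvg : s l @[l --> \oo] -->
    (\sum_(i < k) chart_integral (c i) (w (c i)) (E i))%E.
  apply: cvg_nnesum => i _.
    by near=> l; exact: chart_integral_ge0.
  rewrite [in X in _ --> X](EFU i); apply: chart_integral_cvg => //.
    by move=> a b ab; apply/subsetPset; apply: setIS; exact/subsetPset/ndF.
  by move=> l; rewrite chart_imageI; apply: measurableI => //; exact: mF.
have [l xl] : exists l, (x < s l)%E.
  apply: contrapT => /forallNP xF.
  suff : (\sum_(i < k) chart_integral (c i) (w (c i)) (E i) <= x)%E.
    by rewrite leNgt xs.
  apply: (cvge_le _ scvg).
    by near=> l; rewrite leNgt; apply/negP; exact: xF.
exists l; apply: (lt_le_trans xl); apply: ereal_sup_ubound.
exists k, c, (fun i => E i `&` F l); split => //.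
- by move=> i y [/EF[? _] ?].
- by move=> i; rewrite chart_imageI; apply: measurableI => //; exact: mF.
- by move=> i j _ _ [y [[Ei _] [Ej _]]]; apply: tE => //; exists y.
Unshelve. all: by end_near. Qed.

Lemma form_integral_null (B : set T) :
  (forall c, A c -> lebesgue_tuple (chart_image c B) = 0%E) ->
  chart_measurable B ->
  form_integral A w B = 0%E.
Proof.
move=> B0 mB; apply/eqP; rewrite eq_le form_integral_ge0 andbT.
apply: ge_ereal_sup => _ [k [c [E [Ac EB mE tE ->]]]].
rewrite big1// => i _; have [m mE'] := lebesgue_tuple_sigma_finite R n.
rewrite /chart_integral mE'; apply: null_set_integral => //.
  exact: measurable_fun_chart.
apply: (@subset_measure0 _ _ _ m _ (chart_image (c i) B)) => //.
- exact: mB.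
- by move=> y [cy Ey]; split => //; have [] := EB _ _ Ey.
- by move: (B0 _ (Ac i)); rewrite mE'.
Qed.

End FormIntegral.

(** * The Riemannian density and the positivity of volume *)

Lemma posdef_det_gt0 (R : rcfType) (n : nat) (M : 'M[R]_n) :
  (forall v : 'rV[R]_n, v != 0 -> 0 < (v *m M *m v^T) ord0 ord0) ->
  0 < \det M.
Proof.
(* Every matrix on the segment from the identity to M is invertible. *)
move=> Mpos; rewrite ltNge; apply/negP => detM.
pose P := map_mx polyC 1%:M + 'X *: map_mx polyC (M - 1%:M).
have evalP s : (\det P).[s] = \det (1%:M + s *: (M - 1%:M)).
  rewrite -[LHS]/(horner_eval s (\det P)) -det_map_mx.
  congr (\det _); apply/matrixP => i j.
  rewrite !mxE -[LHS]/(_.[s]) hornerD hornerM hornerX !hornerC.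
  by [].
have [s /andP[s0 s1] ] : exists2 s : R, 0 <= s <= 1 & root (- \det P) s.
  apply: poly_ivt => //; rewrite !hornerN !evalP scale0r addr0 det1 lerN10.
  by rewrite scale1r addrC subrK oppr_ge0.
rewrite rootN /root evalP => /eqP/eqP/det0P[v v0 vN].
have vv : 0 < (v *m v^T) ord0 ord0.
  rewrite mxE lt_neqAle eq_sym; apply/andP; split; last first.
    by apply: sumr_ge0 => i _; rewrite !mxE -expr2 sqr_ge0.
  apply: contra v0 => /eqP vv0; apply/eqP/rowP => i; rewrite mxE.
  move: vv0; under eq_bigr do rewrite mxE -expr2.
  by move=> /psumr_eq0P => /(_ (fun _ _ => sqr_ge0 _)) /(_ i isT) /eqP; rewrite sqrf_eq0 => /eqP.
(* On the kernel vector [v] the quadratic form at parameter [s] vanishes, although it is a convex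
   combination of two positive numbers. *)
have : (1 - s) * (v *m v^T) ord0 ord0 + s * (v *m M *m v^T) ord0 ord0 = 0.
  transitivity ((v *m (1%:M + s *: (M - 1%:M)) *m v^T) ord0 ord0); last first.
    by rewrite vN mul0mx mxE.
  rewrite mulmxDr mulmx1 -scalemxAr mulmxBr mulmx1 mulmxDl -scalemxAl mulmxBl.
  rewrite !mxE; ring.
apply/eqP; rewrite gt_eqF//.
have [->|s_neq0] := eqVneq s 0; first by rewrite subr0 mul1r mul0r addr0.
apply: ltr_wpDl; first by rewrite mulr_ge0 ?subr_ge0 // ltW.
by rewrite mulr_gt0 ?Mpos// lt_neqAle eq_sym s_neq0.
Qed.

Section VolumeForm.
Variables (R : realType) (T : topologicalType) (n : nat).
Variables (A : set (chart R T n)) (g : chart R T n -> T -> 'M[R]_n).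
Hypothesis g_metric : riemannian_metric A g.

Lemma det_continuous : continuous (fun M : 'M[R]_n => \det M).
Proof.
rewrite /determinant; apply: continuous_big => [|s _ M]; first exact: add_continuous.
apply: (@continuous_comp _ _ _ (fun N : 'M[R]_n => \prod_i N i (s i))
  ( *%R ((-1) ^+ s))); last exact: mulrl_continuous.
apply: cvg_big; [exact: mul_continuous|exact: (nbhs_filter M)|move=> i _].
exact: coord_continuous.
Qed.

Lemma volume_form_continuous c : A c -> forall y, cod c y ->
  {for y, continuous (volume_form g c \o param c)}.
Proof.
move=> Ac y cy; have [gs _ _] := g_metric.
(* The empty list of directions in [smooth_on] yields continuity of the metric itself. *)
have [gc _] := gs c Ac [::] y cy.
apply: (@continuous_comp _ _ _ (fun z => \det (g c (param c z))) Num.sqrt).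
  exact: (@continuous_comp _ _ _ (g c \o param c) (fun M => \det M) _ gc (@det_continuous _)).
exact: sqrt_continuous.
Qed.

Lemma volume_form_gt0 c x : A c -> dom c x -> 0 < volume_form g c x.
Proof.
move=> Ac cx; rewrite sqrtr_gt0; apply: posdef_det_gt0.
by have [_ gpos _] := g_metric; have [_] := gpos c Ac x cx.
Qed.

Lemma volume_form_ge0 c x : 0 <= volume_form g c x.
Proof. exact: sqrtr_ge0. Qed.

End VolumeForm.

(** By continuity the density exceeds half its value at [x] on a small coordinate box whose image
    lies in [B], and that box has positive Lebesgue measure. *)
Lemma form_integral_gt0 (R : realType) (T : topologicalType) (n : nat)
    (A : set (chart R T n)) (w : chart R T n -> T -> R)
    (w_ge0 : forall c x, 0 <= w c x)
    (w_cont : forall c, A c ->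
      forall y, cod c y -> {for y, continuous (w c \o param c)})
    (B : set T) (c : chart R T n) (x : T) :
  A c -> dom c x -> nbhs x B -> 0 < w c x ->
  (0 < form_integral A w B)%E.
Proof.
move=> Ac cx nB wx; pose y0 := Defs.coord c x; have cy0 : cod c y0 by exact: coord_cod.
have py0 : param c y0 = x by exact: coordK.
have w2 : w c x / 2 < w c x by rewrite ltr_pdivrMr// ltr_pMr// ltr1n.
have : nbhs y0 [set y : 'rV[R]_n | cod c y /\ (B (param c y) /\ w c x / 2 < w c (param c y))].
  apply: filterI; [|apply: filterI] => /=.
  - by apply: open_nbhs_nbhs; split; [exact: open_cod|].
  - by apply: (continuous_param cy0); rewrite py0.
    suff : nbhs ((w c \o param c) y0) [set r | w c x / 2 < r] by move=> /(w_cont _ Ac _ cy0).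
    by rewrite /= py0; exact: lt_nbhsr.
rewrite -nbhs_ballE => -[e /= e0 eP].
pose Q : set (n.-tuple (measurableTypeR R)) :=
  [set y | forall i, `|y0 ord0 i - tnth y i| < e].
have Qball y : Q y -> ball y0 e (row_of_tuple y).
  by move=> Qy; split => // i j; rewrite [i]ord1 mxE; exact: Qy.
have mQ : measurable Q.
  apply: (measurable_tuple_box (P := fun i => ball (y0 ord0 i) e)).
  by move=> i; apply: open_measurable; exact: ball_open.
(* The box is transported to [T], within the chart domain, so that its chart image is exactly
   [Q]. *)
pose E := dom c `&` Defs.coord c @^-1` ball y0 e.
have EQ : chart_image c E = Q.
  apply/seteqP; split => y /=.
    move=> [cy [_]]; rewrite /= paramK// => -[_ ye] i.
    by have := ye ord0 i; rewrite mxE.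
  move=> Qy; have [cy _] := eP _ (Qball _ Qy); split => //; split.
    exact: param_dom.
  by rewrite /= paramK//; exact: Qball.
have [m mE] := lebesgue_tuple_sigma_finite R n.
have Qgt0 : (0 < m Q)%E by rewrite -mE; exact: lebesgue_tuple_box_gt0.
have EB : E `<=` dom c `&` B.
  move=> z [cz ze]; split => //; have [_ []] := eP _ ze.
  by rewrite coordK.
apply: lt_le_trans (@chart_integral_le_form _ _ _ A w c E B Ac EB _); last by rewrite EQ.
apply: (@lt_le_trans _ _ (\int[m]_(y in Q) (w c x / 2)%:E)%E).
  by rewrite integral_cst// mule_gt0// lte_fin divr_gt0.
rewrite /chart_integral mE EQ; apply: ge0_le_integral => //.
- by move=> y _; rewrite lee_fin divr_ge0.
- by rewrite -EQ; apply: (measurable_fun_chart w_cont Ac).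
- move=> y Qy; rewrite lee_fin ltW//.
  by have [_ []] := eP _ (Qball _ Qy).
Qed.

(** * Volumes of slabs and the formula for the rearrangement of a set *)

Section HalfCylinder.
Variables (R : realType) (m : nat) (Sigma : topologicalType).
Variables (A : set (chart R Sigma m)).
Variable (g : chart R (half_cylinder R Sigma) (1 + m) ->
              half_cylinder R Sigma -> 'M[R]_(1 + m)).
Hypothesis g_metric : riemannian_metric (prod_atlas A) g.
Local Notation M := (half_cylinder R Sigma).
Local Notation vol := (riemannian_volume (prod_atlas A) g).
Local Notation V r := (vol (slab r)).

Let w_ge0 := volume_form_ge0 g.
Let w_cont := volume_form_continuous g_metric.

Lemma val_fst_continuous : continuous (fun x : M => val x.1).
Proof.
move=> x; apply: (@cvg_comp _ _ _ fst val); first exact: cvg_fst.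
exact: initial_continuous.
Qed.

(** In a product chart the half-line coordinate is the first entry of the tuple, so radial sets
    become conditions on one entry. *)
Lemma chart_image_radial (c : chart R Sigma m) (X : set R) :
  chart_image (prod_chart c) [set x | X (val x.1)] =
  @row_of_tuple R _ @^-1` (prod_cod c) `&`
    (fun y => tnth y (lshift m ord0)) @^-1` X.
Proof.
have yE (y : (1 + m).-tuple (measurableTypeR R)) :
    prod_cod c (row_of_tuple y) ->
    val (prod_param c (row_of_tuple y)).1 = tnth y (lshift m ord0).
  by move=> [y0 _]; rewrite [LHS]to_half_lineK// mxE.
apply/seteqP; split => y /= [yc Xy]; split => //.
  by rewrite -(yE _ yc).
by rewrite /= (yE _ yc).
Qed.

Lemma chart_measurable_radial (X : set (measurableTypeR R)) : measurable X ->
  chart_measurable (prod_atlas A) [set x : M | X (val x.1)].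
Proof.
move=> mX _ [c Ac <-]; rewrite chart_image_radial; apply: measurableI.
  by apply: measurable_row_open; exact: prod_open_cod.
rewrite -[X in measurable X]setTI.
exact: (@measurable_tnth _ (measurableTypeR R)).
Qed.

Lemma chart_measurable_slab (r : R) : chart_measurable (prod_atlas A) (slab r%:E).
Proof.
rewrite (_ : slab _ = [set x : M | `]-oo, r[%classic (val x.1)]).
  by apply: chart_measurable_radial; exact: measurable_itv.
by apply/seteqP; split => x; rewrite /slab /= in_itv/= lte_fin.
Qed.

(** In every product chart the slice lies in a coordinate hyperplane. *)
Lemma vol_level (r : R) : vol [set x | val x.1 = r] = 0%E.
Proof.
have mr : measurable ([set r] : set (measurableTypeR R)) by exact: measurable_set1.
apply: (form_integral_null w_cont); last exact: (chart_measurable_radial mr).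
move=> _ [c Ac <-]; have [mu muE] := lebesgue_tuple_sigma_finite R (1 + m).
rewrite muE; apply: (@subset_measure0 _ _ _ mu _
    [set y : (1 + m).-tuple (measurableTypeR R) | tnth y ord0 = r]) => //.
- by apply: (chart_measurable_radial mr); exists c.
- rewrite [X in measurable X](_ : _ =
    (fun y => tnth y ord0) @^-1` ([set r] : set (measurableTypeR R)))//.
  rewrite -[X in measurable X]setTI.
  exact: (@measurable_tnth _ (measurableTypeR R)).
- rewrite (chart_image_radial c [set r]) => y [_ /= <-]; congr tnth.
  exact: val_inj.
- by have := @lebesgue_tuple_hyperplane R m r; rewrite -[m.+1]/(1 + m)%N muE.
Qed.

Lemma le_vol_slab (r s : \bar R) : (r <= s)%E -> (V r <= V s)%E.
Proof.
by move=> rs; apply: le_form_integral => x /= xr; exact: lt_le_trans rs.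
Qed.

Lemma vol_slab0 : V 0%E = 0%E.
Proof.
(* Both sides are empty; the impossible radius -1 makes [vol_level] applicable. *)
have S0 : slab 0%E = [set x : M | val x.1 = -1].
  apply/seteqP; split => x; rewrite /slab /= lte_fin.
    by rewrite ltNge ltW// half_line_gt0.
  by move=> x1; have := half_line_gt0 x.1; rewrite x1 ltrN10.
by rewrite S0 vol_level.
Qed.

Lemma vol_slab_ge0 r : (0 <= V r)%E.
Proof. exact: form_integral_ge0. Qed.

Hypothesis A_cover : forall x, exists2 c, A c & dom c x.
Hypothesis vol_fin : forall r : R, 0 < r -> (V r%:E < +oo)%E.
Hypothesis vol_lim0 : V r%:E @[r --> 0^'+] --> 0%E.

Lemma vol_slab_fin (r : R) : V r%:E \is a fin_num.
Proof.
rewrite ge0_fin_numE ?vol_slab_ge0//.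
have [r0|r0] := ltP 0 r; first exact: vol_fin.
by apply: le_lt_trans (vol_fin ltr01); apply: le_vol_slab; rewrite lee_fin (le_trans r0).
Qed.

(** The shell of radii between [a] and [d] is a neighbourhood of a point over [s], hence has
    positive volume, and superadditivity adds it to the slab. The point [s] matters: over an empty
    [Sigma] all slabs have volume 0. *)
Lemma lt_vol_slab (s : Sigma) (a : R) (b : \bar R) : 0 <= a ->
  (a%:E < b)%E -> (V a%:E < V b)%E.
Proof.
move=> a0 ab.
(* A finite [d] also covers the case where [b] is infinite. *)
have [d ad db] : exists2 d : R, a < d & (d%:E <= b)%E.
  case: b ab => [d|_|//]; last by exists (a + 1); rewrite ?leey// ltrDl.
  by rewrite lte_fin => ad; exists d.
apply: lt_le_trans (le_vol_slab db).
pose B := [set x : M | `]a, d[%classic (val x.1)].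
have slabB : slab a%:E `&` B = set0.
  apply/seteqP; split => // x [].
  rewrite /slab /B /= in_itv/= lte_fin => xa /andP[ax _].
  by move: xa; rewrite ltNge ltW.
have Bd : slab a%:E `|` B `<=` slab d%:E.
  move=> x [|]; rewrite /slab /B /= ?in_itv/= !lte_fin; first by move=> /lt_trans; apply.
  by case/andP.
rewrite /riemannian_volume.
apply: lt_le_trans (le_form_integral (prod_atlas A) (volume_form g) Bd).
apply: lt_le_trans (form_integral_superadditive (prod_atlas A) w_ge0 slabB).
rewrite -[ltLHS]adde0 lteD2lE; last exact: vol_slab_fin.
have [c Ac cs] := A_cover s.
pose x : M := (to_half_line ((a + d) / 2), s).
have x1 : val x.1 = (a + d) / 2.
  by rewrite to_half_lineK// divr_gt0// ltr_wpDl// (le_lt_trans a0).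
apply: (form_integral_gt0 w_ge0 w_cont (c := prod_chart c) (x := x)).
- by exists c.
- by [].
- apply: (@val_fst_continuous x); apply: open_nbhs_nbhs; split.
    exact: interval_open.
  by rewrite x1 /= in_itv /= !(midf_lt ad).
- by apply: (volume_form_gt0 g_metric); [exists c|].
Qed.

(* [vol_level] makes the complement of [slab r] in a bounded slab differ by a
   null set from an increasing union, which turns continuity from below into
   continuity from the right. *)
Lemma vol_slab_right_continuous (r : R) (v : \bar R) : 0 <= r ->
  (forall s, r < s -> (v <= V s%:E)%E) -> (v <= V r%:E)%E.
Proof.
rewrite le_eqVlt => /predU1P[<- vV|r0 vV].
  rewrite vol_slab0; apply: cvge_ge vol_lim0.
  by near=> s; apply: vV; near: s; exact: nbhs_right_gt.
rewrite leNgt; apply/negP => Vv.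
have vfin : v \is a fin_num.
  rewrite ge0_fin_numE; last exact: le_trans (vol_slab_ge0 _) (ltW Vv).
  apply: le_lt_trans (vV (r + 1) _) _; first by rewrite ltrDl.
  by apply: vol_fin; rewrite addr_gt0.
pose F k := [set x : M | `[r + k.+1%:R^-1, r + 1[%classic (val x.1)].
have FU : \bigcup_k F k = [set x | `]r, r + 1[%classic (val x.1)].
  apply/seteqP; split => x /=.
    move=> [k _]; rewrite /F /= !in_itv/= => /andP[xr ->]; rewrite andbT.
    by apply: lt_le_trans xr; rewrite ltrDl.
  rewrite in_itv/= => /andP[rx xr].
  have rx' : 0 < val x.1 - r by rewrite subr_gt0.
  have [k _ /(_ _ (leqnn k)) /= ke] := near_infty_natSinv_lt (PosNum rx').
  by exists k => //; rewrite /F /= in_itv/= xr andbT -lerBrDl ltW.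
have mF k : chart_measurable (prod_atlas A) (F k).
  by apply: chart_measurable_radial; exact: measurable_itv.
have ndF : nondecreasing_seq F.
  move=> i j ij; apply/subsetPset => x; rewrite /F /= !in_itv/= => /andP[xi ->].
  rewrite andbT; apply: le_trans xi; rewrite lerD2l lef_pV2 ?posrE//.
  by rewrite ler_nat.
have mslab := chart_measurable_slab r.
have mlevel : chart_measurable (prod_atlas A) [set x : M | val x.1 = r].
  exact: (chart_measurable_radial (measurable_set1 r)).
have V1 : (V (r + 1)%:E <= V r%:E + vol (\bigcup_k F k))%E.
  pose L := [set x : M | val x.1 = r].
  have -> : slab (r + 1)%:E = (slab r%:E `|` L) `|` \bigcup_k F k.
    rewrite FU; apply/seteqP; split => x; rewrite /slab /L /= in_itv/= !lte_fin.
      by case: (ltgtP (val x.1) r) => [||->]; [left;left|right|left;right].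
    move=> [[xr|->]|/andP[]//]; last by rewrite ltrDl.
    by rewrite (lt_trans xr)// ltrDl.
  apply: le_trans (form_integral_subadditive w_ge0 w_cont _ _ _) _.
  - by move=> c Ac; rewrite chart_imageU; apply: measurableU; [exact: mslab|exact: mlevel].
  - by move=> c Ac; rewrite chart_image_bigcup; apply: bigcupT_measurable => k; exact: mF.
  - rewrite FU; apply/seteqP; split => // x; rewrite /slab /L /= in_itv/= lte_fin.
    move=> [xr /andP[rx _]]; case: xr => xr; move: rx.
      by rewrite ltNge ltW.
    by rewrite xr ltxx.
  rewrite leeD2r//; apply: le_trans (form_integral_subadditive w_ge0 w_cont mslab mlevel _) _.
    by apply/seteqP; split => // x; rewrite /slab /= lte_fin => -[+ xr]; rewrite xr ltxx.
  by rewrite [X in (_ + X)%E]vol_level adde0.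
(* If [V r < v], the shells [F k] fill more than [V (r + 1) - v], so a single one does. This
   contradicts [v + vol (F k) <= V (r + 1)], which holds because [F k] is disjoint from the slab of
   radius [r + k.+1%:R^-1], whose volume is at least [v]. *)
have [k] : exists k, (V (r + 1)%:E - v < vol (F k))%E.
  apply: (form_integral_bigcup_gt w_ge0 w_cont ndF mF).
  rewrite lteBlDr//; apply: le_lt_trans V1 _; rewrite addeC lteD2lE//.
  have : (vol (\bigcup_k F k) <= V (r + 1)%:E)%E.
    rewrite FU; apply: le_form_integral => x; rewrite /slab /= in_itv/= lte_fin.
    by case/andP.
  rewrite ge0_fin_numE ?form_integral_ge0//.
  by move=> /le_lt_trans; apply; rewrite -ge0_fin_numE ?vol_slab_ge0// vol_slab_fin.
apply/negP; rewrite -leNgt leeBrDr//.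
have rk : r < r + k.+1%:R^-1 by rewrite ltrDl.
have rk1 : r + k.+1%:R^-1 <= r + 1 by rewrite lerD2l invf_le1// ler1n.
apply: le_trans (leeD2l _ (vV _ rk)) _; rewrite addeC.
have slabF : slab (r + k.+1%:R^-1)%:E `&` F k = set0.
  apply/seteqP; split => // x; rewrite /slab /F /= in_itv/= lte_fin.
  by move=> [xr /andP[rx _]]; move: xr; rewrite ltNge rx.
apply: le_trans (form_integral_superadditive (prod_atlas A) w_ge0 slabF) _.
apply: le_form_integral => x; rewrite /slab /F /= in_itv/= !lte_fin.
by move=> [/lt_le_trans|/andP[]//]; apply.
Unshelve. all: by end_near. Qed.

(** The slab is the increasing union of the slabs of radius [r - k.+1%:R^-1], so continuity from
    below applies. *)
Lemma vol_slab_left_continuous (r : R) (v : \bar R) :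
  (forall s, s < r -> (V s%:E <= v)%E) -> (V r%:E <= v)%E.
Proof.
move=> Vv; rewrite leNgt; apply/negP.
have -> : slab r%:E = \bigcup_k (slab (r - k.+1%:R^-1)%:E : set M).
  apply/seteqP; split => x.
    rewrite /slab /= lte_fin => xr; have xr' : 0 < r - val x.1 by rewrite subr_gt0.
    have [k _ /(_ _ (leqnn k)) /= ke] := near_infty_natSinv_lt (PosNum xr').
    by exists k => //=; rewrite lte_fin ltrBrDl -ltrBrDr.
  move=> [k _]; rewrite /slab /= !lte_fin => /lt_trans; apply.
  by rewrite gtrBl.
move=> /(form_integral_bigcup_gt w_ge0 w_cont)[].
- move=> i j ij; apply/subsetPset => x; rewrite /slab /= !lte_fin => /lt_le_trans; apply.
  by rewrite lerD2l lerN2 lef_pV2 ?posrE// ler_nat.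
- move=> k; exact: chart_measurable_slab.
- by move=> k; apply/negP; rewrite -leNgt; apply: Vv; rewrite gtrBl.
Qed.

(** The radius is the supremum of those with volume at most [v]; left continuity gives one
    inequality there, right continuity the other. *)
Lemma vol_slab_intermediate (v : \bar R) (r1 : R) : (0 <= v)%E -> 0 <= r1 ->
  (v <= V r1%:E)%E -> exists2 r : R, 0 <= r & V r%:E = v.
Proof.
move=> v0 r10 vV1.
have [V1v|vV1'] := leP (V r1%:E) v.
  by exists r1 => //; apply/eqP; rewrite eq_le V1v.
pose S := [set r : R | 0 <= r /\ (V r%:E <= v)%E].
have S0 : S 0 by split => //; rewrite vol_slab0.
have Sr1 : ubound S r1.
  move=> r [_ Vr]; rewrite leNgt; apply/negP => r1r.
  have := le_vol_slab (ltW r1r : (r1%:E <= r%:E)%E).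
  by rewrite leNgt (le_lt_trans Vr).
have supS : has_sup S by split; [exists 0|exists r1].
have sup0 : 0 <= sup S by apply: ub_le_sup => //; exists r1.
exists (sup S) => //; apply/eqP; rewrite eq_le; apply/andP; split.
  apply: vol_slab_left_continuous => s sS.
  have e0 : 0 < sup S - s by rewrite subr_gt0.
  have [s' [_ Vs']] := sup_adherent e0 supS.
  rewrite opprB addrCA subrr addr0 => ss'.
  by apply: le_trans Vs'; apply: le_vol_slab; rewrite lee_fin ltW.
apply: vol_slab_right_continuous => // s Ss.
have s0 : 0 <= s by rewrite (le_trans sup0)// ltW.
rewrite leNgt; apply/negP => Vs; move: Ss; rewrite ltNge; apply/negP/negPn.
apply: ub_le_sup; first by exists r1.
by split => //; exact: ltW.
Qed.

(** If [B^*] is a slab of radius [r], strict monotonicity turns [val x.1 < r] into a comparison of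
    volumes in which the chosen [r] no longer appears. The bound [r1] guarantees that such a radius
    exists. *)
Lemma symmetric_rearrangementE (B : set M) (r1 : R) : 0 <= r1 ->
  B `<=` slab r1%:E ->
  symmetric_rearrangement vol B = [set x | (V (val x.1)%:E < vol B)%E].
Proof.
move=> r10 B1; have val0 (x : M) : 0 <= val x.1 by rewrite ltW// half_line_gt0.
rewrite /symmetric_rearrangement; case: asboolP => [->|_].
  apply/seteqP; split => // x /=; rewrite ltNge.
  suff -> : vol set0 = 0%E by rewrite vol_slab_ge0.
  by apply/eqP; rewrite eq_le form_integral_ge0 andbT -vol_slab0 le_form_integral.
case: asboolP => [->|_].
  apply/seteqP; split => // x _ /=.
  have -> : setT = slab +oo%E :> set M.
    by apply/seteqP; split => // y _; rewrite /slab /= ltry.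
  by apply: (lt_vol_slab x.2 (val0 x)); rewrite ltry.
case: xgetP => [_ -> [r [r0 -> rB]]|noS].
  rewrite -rB; apply/seteqP; split => x; rewrite /slab /=.
    exact: (lt_vol_slab x.2 (val0 x)).
  by move=> Vx; rewrite ltNge; apply/negP => /le_vol_slab; rewrite leNgt Vx.
(* The default [set0] of [xget] is never reached: some slab has the volume of [B]. *)
have [r r0 rB] := vol_slab_intermediate (form_integral_ge0 _ _ B) r10
  (le_form_integral _ _ B1).
by have := noS (slab r%:E); case; exists r%:E.
Qed.

End HalfCylinder.

(** * Superlevel sets of smooth functions and the layer-cake integral *)

Section ContinuousInCharts.
Variables (R : realType) (T : topologicalType) (n : nat).
Variables (A : set (chart R T n)) (f : T -> R).
Hypothesis f_smooth : smooth_function A f.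

Lemma smooth_function_chart_continuous c : A c -> forall y, cod c y ->
  {for y, continuous (f \o param c)}.
Proof. by move=> Ac y cy; have [] := f_smooth Ac [::] cy. Qed.

Lemma smooth_function_continuous : (forall x, exists2 c, A c & dom c x) ->
  continuous f.
Proof.
move=> A_cover x; have [c Ac cx] := A_cover x.
have near_f : \forall z \near x, (f \o param c) (Defs.coord c z) = f z.
  have : nbhs x (dom c) by apply: open_nbhs_nbhs; split=> //; exact: open_dom.
  by apply: filterS => z cz /=; rewrite coordK.
have fx : (f \o param c) (Defs.coord c x) = f x by rewrite /= coordK.
rewrite /continuous_at -fx; apply: (cvg_trans (near_eq_cvg near_f)).
apply: (@continuous_comp _ _ _ (Defs.coord c) (f \o param c)).
  exact: continuous_coord.
exact: (smooth_function_chart_continuous Ac (coord_cod cx)).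
Qed.

Lemma chart_measurable_superlevel (t : R) : chart_measurable A [set x | t < f x].
Proof.
move=> c Ac.
rewrite (_ : chart_image _ _ = @row_of_tuple R n @^-1`
    (cod c `&` (f \o param c) @^-1` [set r | t < r])) //.
apply: measurable_row_open; rewrite openE => y [cy fy].
apply: filterI; first by apply: open_nbhs_nbhs; split=> //; exact: open_cod.
by apply: (smooth_function_chart_continuous Ac cy); exact: lt_nbhsr.
Qed.

End ContinuousInCharts.

(** Among positive levels [P] is an interval starting at 0, so the integral is its right endpoint;
    openness on the right makes the comparison with [t] strict. *)
Lemma layer_cake_gt (R : realType) (P : set R) (b t : R) :
  (forall u v, 0 < u -> u <= v -> P v -> P u) ->
  (forall u, 0 < u -> P u -> exists2 v, u < v & P v) ->
  (forall u, b <= u -> ~ P u) -> 0 < t ->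
  (t < \int[@lebesgue_measure R]_(u in `]0, +oo[) \1_P u) = (t \in P).
Proof.
move=> Pdec Prc Pb t0; pose J := `]0, +oo[%classic `&` P.
have JE u : J u <-> 0 < u /\ P u by rewrite /J /= in_itv/= andbT.
have mJ : measurable (J : set (measurableTypeR R)).
  apply: is_interval_measurable => u v /JE[u0 Pu] /JE[v0 Pv] w /andP[uw wv].
  have w0 : 0 < w by exact: lt_le_trans uw.
  by apply/JE; split => //; exact: Pdec Pv.
have lt_J x y : x < y -> lebesgue_measure (`]x, y[%classic : set R) = (y - x)%:E.
  by move=> xy; rewrite lebesgue_measure_itv/= lte_fin xy.
rewrite /Rintegral.
have -> : (\int[@lebesgue_measure R]_(u in `]0%R, +oo[) (\1_P u)%:E)%E =
    lebesgue_measure (J : set (measurableTypeR R)).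
  transitivity (\int[@lebesgue_measure R]_(u in `]0%R, +oo[) (\1_J u)%:E)%E.
    by apply: eq_integral => u u0; rewrite !indicE /J in_setI u0.
  by rewrite integral_indic// setIidl// => u [].
have Jle c : 0 < c -> (forall u, c <= u -> ~ P u) -> (lebesgue_measure J <= c%:E)%E.
  move=> c0 Pc; rewrite -(subr0 c) -lt_J//; apply: le_measure; rewrite ?inE//.
  move=> u /JE[u0 Pu]; rewrite /= in_itv/= u0 /=.
  by rewrite ltNge; apply/negP => /Pc.
(* The real integral truncates an infinite value to 0, so finiteness must be known. [Jle] wants a
   positive bound, whence [|b| + 1] instead of [b]. *)
have Jfin : lebesgue_measure J \is a fin_num.
  rewrite ge0_fin_numE//; apply: le_lt_trans (Jle (`|b| + 1) _ _) (ltry _).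
    by rewrite ltr_wpDl.
  move=> u bu; apply: Pb; apply: le_trans bu.
  by rewrite (le_trans (ler_norm b))// lerDl.
apply/idP/idP; rewrite inE.
  move=> tJ; apply: contrapT => Pt; move: tJ; apply/negP; rewrite -leNgt.
  rewrite -lee_fin fineK//; apply: Jle => // u tu Pu.
  exact: Pt (Pdec _ _ t0 tu Pu).
(* A level [v] above [t] still in [P] puts an interval of length [v > t] inside [J]. *)
move=> Pt; have [v tv Pv] := Prc t t0 Pt.
rewrite -lte_fin fineK//; apply: (@lt_le_trans _ _ v%:E); first by rewrite lte_fin.
have v0 : 0 < v by exact: lt_trans tv.
rewrite -(subr0 v) -lt_J//; apply: le_measure; rewrite ?inE//.
move=> u; rewrite /= in_itv/= => /andP[u0 uv]; apply/JE; split => //.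
exact: Pdec (ltW uv) Pv.
Qed.

(** Stated for a general [h] to bound both the radius on the support and [f] itself. *)
Lemma compact_support_bounded (R : realType) (T : topologicalType)
    (f h : T -> R) :
  compact (closure [set x | f x != 0]) -> continuous h ->
  exists2 b, 0 < b & forall x, f x != 0 -> h x < b.
Proof.
move=> cK ch.
have /compact_bounded[M [_ hM]] : compact (h @` closure [set x | f x != 0]).
  by apply: continuous_compact => //; exact: continuous_subspaceT.
(* The compactness bound holds for every number above [M], here [|M| + 1]; one more unit makes the
   inequality strict. *)
exists (`|M| + 2); first by rewrite ltr_wpDl.
move=> x fx; apply: (@le_lt_trans _ _ (`|M| + 1)); last first.
  by rewrite ltrD2l ltr1n.
apply: le_trans (ler_norm _) _; apply: hM.
  by rewrite (le_lt_trans (ler_norm M))// ltrDl.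
by exists x => //; exact: subset_closure.
Qed.

Theorem theorem4p1 (R : realType) (n : nat) (n_gt0 : (0 < n)%N)
  (Sigma : topologicalType) (A : set (chart R Sigma n.-1))
  (SigmaA : oriented_manifold A)
  (g : chart R (half_cylinder R Sigma) (1 + n.-1) ->
       half_cylinder R Sigma -> 'M[R]_(1 + n.-1))
  (g_metric : riemannian_metric (prod_atlas A) g)
  (vol_fin : forall r : R, 0 < r ->
     (riemannian_volume (prod_atlas A) g (slab r%:E) < +oo)%E)
  (vol_lim0 :
     riemannian_volume (prod_atlas A) g (slab r%:E) @[r --> 0^'+] --> 0%E)
  (f : half_cylinder R Sigma -> R)
  (f_ge0 : forall x, 0 <= f x)
  (f_smooth : smooth_function (prod_atlas A) f)
  (f_supp : compact (closure [set x | f x != 0]))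
  (t : R) (t_gt0 : 0 < t) :
  [set x | t <
     decreasing_rearrangement (riemannian_volume (prod_atlas A) g) f x] =
  symmetric_rearrangement (riemannian_volume (prod_atlas A) g)
    [set x | t < f x].
Proof.
have A_cover s : exists2 c, A c & dom c s by have [_ _ []] := SigmaA.
have M_cover x : exists2 c, prod_atlas A c & dom c x.
  by have [c Ac cx] := A_cover x.2; exists (prod_chart c) => //; exists c.
have f_cont := smooth_function_continuous f_smooth M_cover.
have [r r0 fr] := compact_support_bounded f_supp (@val_fst_continuous R Sigma).
have [b b0 fb] := compact_support_bounded f_supp f_cont.
pose vol := riemannian_volume (prod_atlas A) g.
have w_ge0 := volume_form_ge0 g.
have w_cont := volume_form_continuous g_metric.
(* Superlevel sets of positive levels lie in the support, hence in the slab of radius [r]. *)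
have starE u x : 0 < u -> symmetric_rearrangement vol [set y | u < f y] x <->
    (vol (slab (val x.1)%:E) < vol [set y | (u < f y)%R])%E.
  move=> u0; rewrite (symmetric_rearrangementE g_metric A_cover vol_fin vol_lim0 (ltW r0))//.
  move=> y /= uf; rewrite /slab /= lte_fin; apply: fr.
  by rewrite gt_eqF// (lt_trans u0).
apply/funext => x; apply/propext => /=; rewrite starE//.
pose P := [set u : R | (vol (slab (val x.1)%:E) < vol [set y | (u < f y)%R])%E].
have -> : decreasing_rearrangement vol f x =
    \int[@lebesgue_measure R]_(u in `]0, +oo[) \1_P u.
  apply: eq_Rintegral => u; rewrite inE /= in_itv/= andbT => u0.
  by rewrite !indicE; congr (_%:R); congr nat_of_bool; apply/idP/idP; rewrite !inE => /(starE _ _ u0).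
rewrite (@layer_cake_gt _ P b)//; first by rewrite inE.
- move=> u v u0 uv /= /lt_le_trans; apply; apply: le_form_integral => y /=.
  exact: le_lt_trans.
(* Right-openness: the set [f > u] is the increasing union of the sets [f > u + k.+1%:R^-1], so one
   of them already exceeds the given slab volume. *)
- move=> u u0 Pu; pose F k := [set y | u + k.+1%:R^-1 < f y].
  have FU : [set y | u < f y] = \bigcup_k F k.
    apply/seteqP; split => y /=.
      move=> uf; have uf' : 0 < f y - u by rewrite subr_gt0.
      have [k _ /(_ _ (leqnn k)) /= ke] := near_infty_natSinv_lt (PosNum uf').
      by exists k => //; rewrite /F /= -ltrBrDl.
    by move=> [k _]; rewrite /F /=; apply: lt_trans; rewrite ltrDl.
  have [k xk] : exists k, (vol (slab (val x.1)%:E) < vol (F k))%E.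
    apply: (form_integral_bigcup_gt w_ge0 w_cont).
    + move=> i j ij; apply/subsetPset => y; rewrite /F /=; apply: le_lt_trans.
      by rewrite lerD2l lef_pV2 ?posrE// ler_nat.
    + by move=> k; exact: chart_measurable_superlevel f_smooth _.
    + by rewrite -FU.
  by exists (u + k.+1%:R^-1) => //; rewrite ltrDl.
- move=> u bu /=; apply/negP; rewrite -leNgt.
  (* At levels from [b] on the superlevel set is empty, so it lies in the empty slab of radius 0. *)
  apply: (@le_trans _ _ (vol (slab 0%:E))); last first.
    by apply: le_vol_slab; rewrite lee_fin ltW// half_line_gt0.
  apply: le_form_integral => y /= uf.
  have bf : b < f y by exact: le_lt_trans uf.
  have := fb y; rewrite ltNge (ltW bf) gt_eqF ?(lt_trans b0)//.
  by move=> /(_ isT).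
Qed.
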